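(* Let $E$ be a reflexive Banach space with $E = V \oplus W$, where $V$ and $W$ are linear subspaces and $\dim V < +\infty$. Let $\Phi\colon E \to \mathbb{R}$ be a $C^1$-functional satisfying: (i) $\Phi$ is coercive on $W$, i.e. $\Phi(w) \to +\infty$ as $\|w\| \to \infty$, $w \in W$; (ii) for every $w \in W$, the map $v \mapsto \Phi(v+w)$, $V \to \mathbb{R}$, is quasi-concave; (iii) $\Phi(v+w) \to -\infty$ as $\|v\| \to +\infty$ ($v\in V$), uniformly for $w$ in bounded subsets of $W$; (iv) for every $v \in V$, the map $w \mapsto \Phi(v+w)$, $W\to\mathbb{R}$, is weakly lower semi-continuous. Then $\Phi$ admits a critical point $u \in E$ (i.e. $\Phi'(u)=0$) with $\Phi(u) = c$, where $$c = \min_{w \in W} \max_{v \in V} \Phi(v+w).$$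
   Context: A function $f\colon V \to \mathbb{R}$ is quasi-concave if $f(tx+(1-t)y) \ge \min\{f(x), f(y)\}$ for all $x,y \in V$ and $t \in [0,1]$ (equivalently, all superlevel sets $\{f \ge \alpha\}$ are convex). *)

(* Defs.v *)
From HB Require Import structures.
From mathcomp Require Import all_boot all_order all_algebra.
From mathcomp Require Import all_classical all_reals all_analysis.
Set Implicit Arguments. Unset Strict Implicit. Unset Printing Implicit Defensive.
Import Order.TTheory GRing.Theory Num.Theory.
Import numFieldNormedType.Exports.
Local Open Scope classical_set_scope.
Local Open Scope ring_scope.

Section Defs.
Context {R : realType} {E : normedModType R}.

Definition dual_elt (f : E -> R) : Prop :=
  (forall (a : R) (x y : E), f (a *: x + y) = a * f x + f y) /\ continuous f.

Definition subspace (V : set E) : Prop :=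
  V 0 /\ (forall x y, V x -> V y -> V (x + y)) /\
  (forall (a : R) x, V x -> V (a *: x)).

Definition finite_dim (V : set E) : Prop :=
  exists (n : nat) (b : 'I_n -> E),
    V = [set x | exists c : 'I_n -> R, x = \sum_(i < n) c i *: b i].

Definition direct_sum (V W : set E) : Prop :=
  subspace V /\ subspace W /\
  (forall u : E, exists v w, V v /\ W w /\ u = v + w) /\
  (forall v1 w1 v2 w2, V v1 -> W w1 -> V v2 -> W w2 ->
     v1 + w1 = v2 + w2 -> v1 = v2 /\ w1 = w2).

(* reflexive: the canonical embedding J : E -> E'' is onto, i.e. every
   bounded linear functional on the dual E' is evaluation at some x in E.
   The bound |phi f| <= C ||f||_{E'} is written without naming the dual norm:
   whenever |f x| <= M ||x|| for all x, then |phi f| <= C M. *)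
Definition reflexive_space : Prop :=
  forall phi : (E -> R) -> R,
    (forall (a : R) f g, dual_elt f -> dual_elt g ->
        phi (fun x => a * f x + g x) = a * phi f + phi g) ->
    (exists C : R, forall f (M : R), dual_elt f -> 0 <= M ->
        (forall x, `|f x| <= M * `|x|) -> `|phi f| <= C * M) ->
    exists x : E, forall f, dual_elt f -> phi f = f x.

Definition C1 (Phi : E -> R) : Prop :=
  (forall u, differentiable Phi u) /\
  (forall u (eps : R), 0 < eps -> exists delta : R, 0 < delta /\
     forall u', `|u' - u| < delta ->
       forall h, `|'d Phi u' h - 'd Phi u h| <= eps * `|h|).

Definition quasi_concave_on (V : set E) (f : E -> R) : Prop :=
  forall x y (t : R), V x -> V y -> 0 <= t <= 1 ->
    Num.min (f x) (f y) <= f (t *: x + (1 - t) *: y).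

(* lower semicontinuity on W for the (relative) weak topology sigma(E,E'):
   basic weak neighbourhoods of w0 are given by finitely many f in E'. *)
Definition weakly_lsc_on (W : set E) (g : E -> R) : Prop :=
  forall w0, W w0 -> forall eps : R, 0 < eps ->
    exists (fs : seq (E -> R)) (delta : R),
      (forall f, f \in fs -> dual_elt f) /\ 0 < delta /\
      forall w, W w -> (forall f, f \in fs -> `|f w - f w0| < delta) ->
        g w0 - eps < g w.

Definition is_minmax (Phi : E -> R) (V W : set E) (c : R) : Prop :=
  (forall w, W w -> exists v, V v /\ forall v', V v' -> Phi (v' + w) <= Phi (v + w)) /\
  (exists w0, W w0 /\ (exists v0, V v0 /\ Phi (v0 + w0) = c) /\
     forall v, V v -> Phi (v + w0) <= c) /\
  (forall w, W w -> exists v, V v /\ c <= Phi (v + w)).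

End Defs.
Arguments reflexive_space R E : clear implicits.

(* Main.v *)
Require Import Defs.
From HB Require Import structures.
From mathcomp Require Import all_boot all_order all_algebra.
From mathcomp Require Import all_classical all_reals all_analysis.
From mathcomp Require Import lra.
Import Order.TTheory GRing.Theory Num.Theory.
Import numFieldNormedType.Exports.
Local Open Scope classical_set_scope.
Local Open Scope ring_scope.

(* Let psi w = max_v Phi(v + w). Since psi is weakly lower semicontinuous and
   coercive on W, reflexivity yields a minimizer w0: it is the weak limit of an
   ultrafilter of sublevel sets of psi. Let K be the compact convex set of
   maximizers of v |-> Phi(v + w0). For h in W, minimality of w0 gives a point of K
   where dPhi(v + w0) h >= 0, and quasi-concavity makes the set of such points
   convex. As dPhi is linear in h, a connectedness argument in the style of
   Komiya's proof of Sion's minimax theorem gives one v in K that works for all h;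
   there dPhi vanishes on W, and it vanishes on V because v is a maximizer. *)

(** * Connectedness and a minimax theorem for linear families *)

Lemma connected_closed_meet (T : topologicalType) (S A B : set T) :
  connected S -> closed A -> closed B -> S `<=` A `|` B ->
  S `&` A !=set0 -> S `&` B !=set0 -> S `&` A `&` B !=set0.
Proof.
move=> cS cA cB SAB nA [b [Sb Bb]].
have [//|h] := pselect (S `&` A `&` B !=set0).
(* If the triple intersection is empty, the trace of [A] on [S] is also the trace of the open
   complement of [B]; being clopen in [S], it is all of [S], so [b] lies in it. *)
suff : S `&` A = S by move=> E; exists b; rewrite E.
apply: cS => //; last by exists A.
exists (~` B); first exact: closed_openC.
apply/seteqP; split=> x [Sx].
  by move=> Ax; split=> // Bx; apply: h; exists x.
by move=> nBx; split=> //; case: (SAB x Sx).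
Qed.

Definition segment_closed {R : realType} {E : normedModType R} (S : set E) :=
  forall x y (t : R), S x -> S y -> 0 <= t <= 1 -> S (t *: x + (1 - t) *: y).

Section Minimax.
Context {R : realType} {E H : normedModType R} (F : H -> E -> R).
Variable W : set H.
Hypothesis subW : Defs.subspace W.
Hypothesis F_lin :
  forall (a : R) h k x, F (a *: h + k) x = a * F h x + F k x.
Hypothesis F_cont : forall h, continuous (F h).

Let C h := [set x | 0 <= F h x].

Lemma closed_ge0_level h : closed (C h).
Proof.
apply: (@preimage_closed _ _ (F h) [set y | 0 <= y]); last exact: closed_ge.
by move=> x _; exact: F_cont.
Qed.

(* If the two sets were disjoint, [0, 1] would be covered by the two closed sets
   of parameters t for which the level set of (1 - t) h + t k meets C h,
   respectively C k; a common parameter then gives a segment joining C h to C k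
   inside their union. *)
Lemma ge0_levels_meet (K : set E) h k : W h -> W k -> compact K ->
  (forall l, W l -> segment_closed (K `&` C l)) ->
  (forall l, W l -> K `&` C l !=set0) ->
  K `&` C h `&` C k !=set0.
Proof.
move=> Wh Wk cK segK neK; case: subW => _ [WD WZ].
pose G (p : R * E) := (1 - p.1) * F h p.2 + p.1 * F k p.2.
pose m (t : R) := (1 - t) *: h + t *: k.
have F0 x : F 0 x = 0 by have := F_lin 1 0 0 x; rewrite scaler0 addr0; lra.
have mE t x : F (m t) x = G (t, x).
  by rewrite F_lin /G -[t *: k]addr0 F_lin F0 addr0.
have Wm t : W (m t) by apply: (WD); exact: WZ.
have cG : continuous G.
  move=> p; apply: cvgD; apply: cvgM.
  - by apply: cvgB; [exact: cvg_cst|exact: cvg_fst].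
  - by apply: (@continuous_comp _ _ _ snd (F h)); [exact: cvg_snd|exact: F_cont].
  - exact: cvg_fst.
  - by apply: (@continuous_comp _ _ _ snd (F k)); [exact: cvg_snd|exact: F_cont].
have c01 : compact (`[0, 1]%classic : set R) by exact: segment_compact.
(* Parameters [t] for which the level set of [m t] meets [C l] inside [K]. As the projection of a
   compact set, [J l] is closed. *)
pose J l := fst @` ((`[0, 1]%classic `*` (K `&` C l)) `&` [set p | 0 <= G p]).
have cJ l : closed (J l).
  apply: compact_closed; first exact: norm_hausdorff.
  apply: continuous_compact.
    by apply: continuous_subspaceT => p; exact: cvg_fst.
  apply: compact_closedI.
    by apply: compact_setX => //; apply: compact_closedI => //;
    exact: closed_ge0_level.
  by apply: (@preimage_closed _ _ G [set y | 0 <= y]); [move=> x _; exact: cG|exact: closed_ge].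
have JP l t x : 0 <= t <= 1 -> K x -> C l x -> C (m t) x -> J l t.
  by move=> t01 Kx Clx; rewrite /C /= mE => Gx; exists (t, x) => //.
(* A convex combination of two negative numbers is negative, so [C (m t)] is covered by [C h] and
   [C k]. *)
have split_C t x : 0 <= t <= 1 -> C (m t) x -> C h x \/ C k x.
  move=> t01; rewrite /C /= mE /G /= => G0.
  have [|Fh] := leP 0 (F h x); first by left.
  have [|Fk] := leP 0 (F k x); first by right.
  exfalso; nra.
have [t [[t01 [[t1 a] [[_ [/= Ka Ca]] Ga] /= ta]] [[t2 b] [[_ [/= Kb Cb]] Gb] /= tb]]] :
    `[0, 1]%classic `&` J h `&` J k !=set0.
  apply: connected_closed_meet => //; first exact: segment_connected.
  - move=> t /=; rewrite in_itv /= => t01.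
    have [x [Kx Cx]] := neK _ (Wm t).
    by case: (split_C _ _ t01 Cx) => ?; [left|right]; exact: (JP _ _ x).
  - have [x [Kx Cx]] := neK _ Wh; exists 0; split; first by rewrite /= in_itv/=; lra.
    by apply: (JP h 0 x) => //; [lra|rewrite /C /= mE /G /=; move: Cx; rewrite /C /=; lra].
  - have [x [Kx Cx]] := neK _ Wk; exists 1; split; first by rewrite /= in_itv/=; lra.
    by apply: (JP k 1 x) => //; [lra|rewrite /C /= mE /G /=; move: Cx; rewrite /C /=; lra].
move: t01; rewrite /= in_itv /= => t01; subst t1 t2.
have Cma : C (m t) a by rewrite /C /= mE.
have Cmb : C (m t) b by rewrite /C /= mE.
pose f (s : R) := s *: a + (1 - s) *: b.
have cf : continuous f.
  move=> s; apply: cvgD; apply: cvgZr_tmp; first exact: cvg_id.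
  by apply: cvgB; [exact: cvg_cst|exact: cvg_id].
have Kf s : 0 <= s <= 1 -> K (f s) /\ C (m t) (f s).
  by move=> s01; apply: (segK _ (Wm t)).
have cfC l : closed (f @^-1` (C l)).
  by apply: preimage_closed; [move=> x _; exact: cf|exact: closed_ge0_level].
have [s [[s01 Ch] Ck]] : `[0, 1]%classic `&` (f @^-1` (C h)) `&` (f @^-1` (C k)) !=set0.
  apply: connected_closed_meet => //; first exact: segment_connected.
  - move=> s; rewrite /= in_itv /= => s01.
    by have [_ /(split_C _ _ t01)] := Kf _ s01.
  - exists 1; split; first by rewrite /= in_itv/=; lra.
    by rewrite /preimage /= /f subrr scale0r addr0 scale1r.
  - exists 0; split; first by rewrite /= in_itv/=; lra.
    by rewrite /preimage /= /f subr0 scale0r add0r scale1r.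
move: s01; rewrite /= in_itv /= => /Kf [Kfs _].
by exists (f s).
Qed.

(** Induction on [s] with [K] varying: intersecting [K] with one level set preserves compactness and
    convexity, and [ge0_levels_meet] preserves nonemptiness. *)
Lemma finite_ge0_levels_meet (s : seq H) (K : set E) :
  (forall h, h \in s -> W h) -> compact K ->
  (forall l, W l -> segment_closed (K `&` C l)) ->
  (forall l, W l -> K `&` C l !=set0) ->
  exists2 x, K x & forall h, h \in s -> 0 <= F h x.
Proof.
elim: s K => [|k s IH] K sW cK segK neK.
  by have [x [Kx _]] := neK 0 (proj1 subW); exists x.
have Wk : W k by apply: sW; rewrite mem_head.
have [||||x [Kx Ckx] sx] := IH (K `&` C k).
- by move=> h hs; apply: sW; rewrite inE hs orbT.
- by apply: compact_closedI => //;
    exact: closed_ge0_level.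
- move=> l Wl x y t [[Kx Ckx] Clx] [[Ky Cky] Cly] t01.
  have [Kz Ckz] := segK _ Wk _ _ _ (conj Kx Ckx) (conj Ky Cky) t01.
  by have [_ Clz] := segK _ Wl _ _ _ (conj Kx Clx) (conj Ky Cly) t01.
- by move=> l Wl; exact: ge0_levels_meet.
exists x => // h; rewrite inE => /orP[/eqP ->|/sx //].
exact: Ckx.
Qed.

(* A special case of Sion's minimax theorem, by Komiya's argument. *)
Lemma ge0_levels_common (K : set E) : compact K ->
  (forall l, W l -> segment_closed (K `&` C l)) ->
  (forall l, W l -> K `&` C l !=set0) ->
  exists2 x, K x & forall h, W h -> 0 <= F h x.
Proof.
move=> cK segK neK.
have := cK; rewrite compact_In0 => /(_ H W (fun h => K `&` C h)) [||x capx].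
- by exists C => // h _; exact: closed_ge0_level.
- move=> D' D'W.
  have [|x Kx D'x] := @finite_ge0_levels_meet (finmap.enum_fset D') K _ cK segK neK.
    by move=> h hD; have := D'W h hD; rewrite inE.
  by exists x => h /= hD; split=> //; exact: D'x.
exists x; first by have [] := capx 0 (proj1 subW).
by move=> h /capx[].
Qed.

End Minimax.

(** * Bases and coordinates in finite dimension *)

Lemma finite_dim_free {R : realType} {E : normedModType R} (V : set E) :
  finite_dim V ->
  exists (n : nat) (b : 'I_n -> E),
    V = [set x | exists c : 'I_n -> R, x = \sum_(i < n) c i *: b i] /\
    forall c : 'I_n -> R, \sum_(i < n) c i *: b i = 0 -> forall i, c i = 0.
Proof.
case=> n; elim: n => [|n IH] [b VE].
  by exists 0%N, b; split => // c _ [].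
have [fr|] := pselect (forall c : 'I_n.+1 -> R,
    \sum_(i < n.+1) c i *: b i = 0 -> forall i, c i = 0).
  by exists n.+1, b.
move=> /existsNP[c] /not_implyP[c0] /existsNP[j] /eqP cj.
apply: IH; exists (fun i => b (lift j i)); rewrite VE.
have bj : b j = \sum_(i < n) - ((c j)^-1 * c (lift j i)) *: b (lift j i).
  move: c0; rewrite (bigD1_ord j) //= => /eqP; rewrite addr_eq0 => /eqP c0.
  rewrite -[LHS](scalerK cj) c0 scalerN scaler_sumr -sumrN.
  by apply: eq_bigr => i _; rewrite scalerA scaleNr.
apply/seteqP; split=> x [d ->].
  exists (fun i => d (lift j i) - d j * ((c j)^-1 * c (lift j i))).
  rewrite (bigD1_ord j) //= bj scaler_sumr -big_split /=.
  by apply: eq_bigr => i _; rewrite scalerA -scalerDl mulrN addrC.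
exists (fun i => if unlift j i is Some k then d k else 0).
rewrite [RHS](bigD1_ord j) //= unlift_none scale0r add0r.
by apply: eq_bigr => i _; rewrite liftK.
Qed.

(** Coefficients are a row vector, so that the norm and the compactness of closed bounded sets in
    ['rV[R]_n] are at hand. *)
Definition lin_comb {R : realType} {E : normedModType R} {n : nat}
  (b : 'I_n -> E) (c : 'rV[R]_n) : E := \sum_(i < n) c 0 i *: b i.

Lemma continuous_lin_comb {R : realType} {E : normedModType R} {n : nat}
  (b : 'I_n -> E) : continuous (lin_comb b).
Proof.
apply: continuous_big; first exact: add_continuous.
by move=> i _ c; apply: (@cvgZr_tmp _ _ _ (nbhs c)); exact: coord_continuous.
Qed.

(** On the compact unit sphere of coefficients the distances to [W] have a common positive lower
    bound [e]; homogeneity then gives the bound with [k = e^-1]. *)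
Lemma lin_comb_coord_bound {R : realType} {E : normedModType R} {n : nat}
  (b : 'I_n -> E) (W : set E) :
  (forall (a : R) w, W w -> W (a *: w)) ->
  (forall c, c != 0 -> exists2 d : R, 0 < d &
     forall w, W w -> d <= `|lin_comb b c - w|) ->
  exists2 k : R, 0 < k & forall c w, W w -> `|c| <= k * `|lin_comb b c + w|.
Proof.
move=> WZ dist.
pose S := [set c : 'rV[R]_n | `|c| = 1].
have cS : compact S.
  apply: bounded_closed_compact.
    exists 1; split; first exact: num_real.
    by move=> x x1 c /= ->; exact: ltW.
  apply: (@preimage_closed _ R (fun c : 'rV[R]_n => `|c|) [set 1]).
    by move=> c _; exact: norm_continuous.
  exact: closed_eq.
pose P (e : R) (c : 'rV[R]_n) := forall w, W w -> e <= `|lin_comb b c - w|.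
have [e e0 SP] : exists2 e : R, 0 < e & S `<=` P e.
  have nS : \forall e \near 0^'+, S `<=` P e.
    apply: ((proj1 (compact_near_coveringP S)) cS) => c Sc.
    have [|d d0 dP] := dist c.
      by apply/eqP => c0; move: Sc; rewrite /S /= c0 normr0; lra.
    (* Moving from [c] to [c'] costs less than half of the distance [d]; the other half stays as a
       lower bound. *)
    exists ([set c' | `|lin_comb b c - lin_comb b c'| < d / 2], [set e | e < d / 2]).
      split; last by apply: nbhs_right_lt; lra.
      have /cvgrPdist_lt := @continuous_lin_comb _ _ _ b c.
      by apply; lra.
    move=> [c' e] [/= c'd ed] w Ww.
    have := dP w Ww; have := ler_distD (lin_comb b c') (lin_comb b c) w.
    lra.
  near (0 : R)^'+ => e; exists e; first by [].
  by near: e.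
exists e^-1; first by rewrite invr_gt0.
move=> c w Ww; have [->|c0] := eqVneq c 0.
  by rewrite normr0 mulr_ge0// invr_ge0 ltW.
have nc : 0 < `|c| by rewrite normr_gt0.
have LZ (a : R) : lin_comb b (a *: c) = a *: lin_comb b c.
  by rewrite /lin_comb scaler_sumr; apply: eq_bigr => i _; rewrite mxE scalerA.
(* The minus sign in the chosen element of [W] turns the difference in [P] into the sum of the
   conclusion. *)
have := SP (`|c|^-1 *: c) _ (- `|c|^-1 *: w) (WZ _ _ Ww).
rewrite LZ scaleNr opprK -scalerDr normrZ normfV normr_id => /(_ _)/wrap[].
  by rewrite /S /= normrZ normfV normr_id mulVf// normr_eq0.
by rewrite ler_pdivlMl // mulrC -ler_pdivlMl.
Unshelve. all: by end_near.
Qed.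

(** * Bounded functionals and weak limits of ultrafilters *)

Lemma dual_elt_bounded {R : realType} {E : normedModType R} (f : E -> R) :
  dual_elt f -> exists2 M : R, 0 <= M & forall x, `|f x| <= M * `|x|.
Proof.
move=> [fl fc].
have f0 : f 0 = 0 by have := fl 1 0 0; rewrite scaler0 addr0; lra.
have fZ a x : f (a *: x) = a * f x by rewrite -[a *: x]addr0 fl f0 addr0.
have /cvgrPdist_le/(_ 1 ltr01) := fc 0.
rewrite f0 => /nbhs_norm0P [d /= d0 df].
(* Values of [f] are at most 1 in absolute value on the open ball of radius [d]; rescaling [x] to
   norm [d / 2] gives this constant. *)
exists (2 / d); first by rewrite divr_ge0// ltW.
move=> x; have [->|x0] := eqVneq x 0; first by rewrite f0 !normr0 mulr0.
have nx : 0 < `|x| by rewrite normr_gt0.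
have k0 : 0 < d / 2 / `|x| by rewrite !divr_gt0.
have := df ((d / 2 / `|x|) *: x).
rewrite /= normrZ sub0r normrN fZ [`|_ * f x|]normrM (gtr0_norm k0).
rewrite divfK ?normr_eq0// => /(_ _)/wrap[]; first by move: d0; lra.
rewrite -ler_pdivlMl// mulr1 => /le_trans; apply.
by rewrite !invf_div mulrC.
Qed.

(** Compactness gives a cluster point of the image, and for an ultrafilter a cluster point is a
    limit. *)
Lemma ultrafilter_cvg {R : realType} {T : Type} (U : set_system T)
  (f : T -> R) (A : set R) :
  UltraFilter U -> compact A -> U (f @^-1` A) -> exists2 p : R, A p & f @ U --> p.
Proof.
move=> ultU cA UA.
have [p [Ap clp]] := cA (f @ U) _ UA.
exists p => // N Np; have [//|UN] := in_ultra_setVsetC (f @^-1` N) ultU.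
by have [x []] := clp (~` N) N UN Np.
Qed.

(** Weak compactness of balls: taking the limit of [f] along [U] is a linear functional of [f],
    bounded by [r], and reflexivity represents it by a point. *)
Lemma reflexive_ultrafilter_cvg {R : realType} {E : normedModType R}
    (U : set_system E) (r : R) :
  reflexive_space R E -> UltraFilter U -> U [set x | `|x| <= r] ->
  exists x : E, forall f, dual_elt f -> f @ U --> f x.
Proof.
move=> refl ultU Ur.
have PU : ProperFilter U by exact: ultra_proper.
have lb f M : dual_elt f -> 0 <= M -> (forall x, `|f x| <= M * `|x|) ->
    exists2 p, `|p| <= r * M & f @ U --> p.
  move=> df M0 fM.
  have [|p /= pA fp] := @ultrafilter_cvg _ _ U f `[- (r * M), r * M]%classic
      ultU (@segment_compact _ _ _).
    apply: filterS Ur => x /= xr; rewrite in_itv /= -ler_norml.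
    by apply: le_trans (fM x) _; rewrite mulrC ler_wpM2r.
  by exists p => //; rewrite ler_norml; move: pA; rewrite /= in_itv.
have fcvg f : dual_elt f -> f @ U --> lim (f @ U).
  move=> df; have [M M0 fM] := dual_elt_bounded _ df.
  by have [p _ fp] := lb f M df M0 fM; rewrite (cvg_lim _ fp).
have [||x fx] := refl (fun f => lim (f @ U)).
- move=> a f g df dg; apply: cvg_lim => //.
  apply: cvgD; last exact: fcvg.
  by apply: cvgM; [exact: cvg_cst|exact: fcvg].
- exists r => f M df M0 fM.
  by have [p pr fp] := lb f M df M0 fM; rewrite (cvg_lim _ fp).
by exists x => f df; rewrite -fx//; exact: fcvg.
Qed.

(** * Differentials along rays *)

Section Differential.
Context {R : realType} {E : normedModType R} (Phi : E -> R).

Lemma diff_ray_approx (u h : E) (eps : R) : differentiable Phi u -> 0 < eps ->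
  exists2 d : R, 0 < d & forall s, 0 < s < d ->
    `|Phi (u + s *: h) - Phi u - s * 'd Phi u h| <= eps * s.
Proof.
move=> dPhi eps0.
have := @diff_derivable _ _ _ _ _ h dPhi.
rewrite /derivable => /cvgrPdist_le /(_ eps eps0).
rewrite -[lim _]/('D_h Phi u) deriveE// => /nbhs_norm0P[d /= d0 dP].
exists d => // s /andP[s0 sd].
have := dP s; rewrite /= gtr0_norm// => /(_ sd).
rewrite gt_eqF// => /(_ isT).
rewrite distrC [s *: h + u]addrC => /(ler_wpM2r (ltW s0)); apply: le_trans.
rewrite -[X in _ <= _ * X](gtr0_norm s0) -normrM mulrBl [_ *: _ * s]mulrAC.
by rewrite mulVf ?gt_eqF// mul1r [s * _]mulrC.
Qed.

(** Were the derivative below [a], a first-order expansion with error half the gap would stay under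
    slope [a] for all small steps. *)
Lemma diff_ge_of_ray_ge (u h : E) (a : R) : differentiable Phi u ->
  (forall e, 0 < e -> exists2 s, 0 < s < e & Phi u + s * a <= Phi (u + s *: h)) ->
  a <= 'd Phi u h.
Proof.
move=> dPhi ray; rewrite leNgt; apply/negP => lt.
have [|d d0 dP] := @diff_ray_approx u h ((a - 'd Phi u h) / 2) dPhi; first lra.
have [s sd us] := ray d d0.
have := dP s sd; rewrite ler_norml => /andP[_]; nra.
Qed.

Lemma diff_MVT (u h : E) (s : R) : (forall x, differentiable Phi x) -> 0 < s ->
  exists2 t, 0 < t < s & Phi (u + s *: h) - Phi u = s * 'd Phi (u + t *: h) h.
Proof.
move=> dPhi s0; pose g (t : R) := Phi (u + t *: h).
have gE t : (fun k : R => k^-1 *: ((g \o shift t) (k *: 1) - g t)) =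
    (fun k : R => k^-1 *: ((Phi \o shift (u + t *: h)) (k *: h) - Phi (u + t *: h))).
  apply/funext => k; rewrite /g /= -[k *: 1]/(k * 1) mulr1 scalerDl.
  by rewrite addrCA.
have dg (t : R) : is_derive t (1 : R) g ('d Phi (u + t *: h) h).
  apply: DeriveDef.
    by rewrite /derivable gE; exact: diff_derivable.
  by rewrite /derive gE -deriveE.
have cg : {within `[0, s], continuous g}.
  apply: continuous_subspaceT => t.
  by apply: differentiable_continuous; apply/derivable1_diffP; have [] := dg t.
have [t] := MVT s0 (fun t _ => dg t) cg.
rewrite in_itv /= => ts; rewrite /g scale0r addr0 subr0 mulrC => eq.
by exists t.
Qed.

Lemma C1_continuous_diff (h : E) : C1 Phi -> continuous (fun u => 'd Phi u h).
Proof.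
move=> [_ c1] u; apply/cvgrPdist_le => eps eps0.
have h1 : 0 < `|h| + 1 by rewrite ltr_wpDl.
have [|d [d0 dP]] := c1 u (eps / (`|h| + 1)); first by rewrite divr_gt0.
apply/nbhs_normP; exists d => //= u' uu'.
rewrite distrC; apply: le_trans (dP u' _ h) _; first by rewrite distrC.
rewrite -mulrA; apply: ler_piMr; first exact: ltW.
by rewrite ler_pdivrMl// mulr1 lerDl.
Qed.

End Differential.

(** * Coordinates of the component in [V], and separation from [W] *)

Section Coordinates.
Context {R : realType} {E : normedModType R} (V W : set E).
Hypothesis VW : direct_sum V W.
Hypothesis dimV : finite_dim V.
Hypothesis dist_pos : forall v, V v -> v != 0 ->
  exists2 d : R, 0 < d & forall w, W w -> d <= `|v - w|.

(** Freeness of [b] turns [dist_pos], which says that [V] meets the closure of [W] only in 0, into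
    the hypothesis of [lin_comb_coord_bound]. *)
Lemma direct_sum_coords : exists (n : nat) (b : 'I_n -> E) (k : R),
  [/\ V = range (lin_comb b), 0 < k &
  forall c w, W w -> `|c| <= k * `|lin_comb b c + w|].
Proof.
have [n [b [VE free]]] := finite_dim_free _ dimV.
have [_ [[_ [_ WZ]] _]] := VW.
have VL c : V (lin_comb b c) by rewrite VE; exists (fun i => c 0 i).
have [|k k0 kP] := lin_comb_coord_bound b W WZ.
  move=> c c0; apply: dist_pos => //; apply: contra c0 => /eqP /free ci.
  by apply/eqP/rowP => i; rewrite ci mxE.
exists n, b, k; split => //; apply/seteqP; split=> x; last by case=> c _ <-.
rewrite VE => -[c ->]; exists (\row_i c i) => //.
by apply: eq_bigr => i _; rewrite mxE.
Qed.

(** The coordinate bound with [w = 0] places the ball inside the continuous image of a compact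
    coordinate ball. *)
Lemma compact_finite_dim_ball (r : R) : compact (V `&` [set x | `|x| <= r]).
Proof.
have [n [b [k [-> k0 kP]]]] := direct_sum_coords.
have [_ [[W0 _] _]] := VW.
pose B := [set c : 'rV[R]_n | `|c| <= k * r].
have -> : range (lin_comb b) `&` [set x | `|x| <= r] =
    (lin_comb b @` B) `&` [set x | `|x| <= r].
  apply/seteqP; split=> x [[c _ <-] /= xr]; split => //; exists c => //.
  apply: le_trans (kP c 0 W0) _; rewrite addr0.
  by rewrite ler_wpM2l// ltW.
apply: compact_closedI.
  apply: continuous_compact.
    exact/continuous_subspaceT/continuous_lin_comb.
  apply: bounded_closed_compact.
    exists (k * r); split; first exact: num_real.
    by move=> x x1 c /= cr; exact/ltW/(le_lt_trans cr).
  apply: (@preimage_closed _ R (fun c : 'rV[R]_n => `|c|) [set y | y <= k * r]).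
    by move=> c _; exact: norm_continuous.
  exact: closed_le.
apply: (@preimage_closed _ R (fun x : E => `|x|) [set y | y <= r]).
  by move=> c _; exact: norm_continuous.
exact: closed_le.
Qed.

(** The functional is a coordinate of the component in [V]. It serves to show that a weak limit of
    points of [W] stays in [W]. *)
Lemma dual_elt_separates (u : E) : ~ W u ->
  exists f : E -> R, [/\ dual_elt f, forall w, W w -> f w = 0 & f u != 0].
Proof.
have [n [b [k [VE k0 kP]]]] := direct_sum_coords.
have [_ [[W0 [WD WZ]] [decomp _]]] := VW.
pose L := lin_comb b.
have Llin a c d : L (a *: c + d) = a *: L c + L d.
  rewrite /L /lin_comb scaler_sumr -big_split; apply: eq_bigr => i _ /=.
  by rewrite !mxE scalerDl scalerA.
have WN w : W w -> W (- w) by rewrite -scaleN1r; exact: WZ.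
have L0 : L 0 = 0.
  by have := Llin 1 0 0; rewrite scaler0 !addr0 scale1r => /eqP;
    rewrite -subr_eq subrr eq_sym => /eqP.
have /choice[co coP] : forall x, exists c, W (x - L c).
  move=> x; have [v [w [Vv [Ww ->]]]] := decomp x.
  move: Vv; rewrite VE => -[c _ <-]; exists c.
  by rewrite addrC addKr.
have LW0 c : W (L c) -> c = 0.
  move=> WL; apply/eqP; rewrite -normr_le0.
  by apply: le_trans (kP c _ (WN _ WL)) _; rewrite subrr normr0 mulr0.
have co_uniq x c : W (x - L c) -> co x = c.
  move=> Wx; apply/eqP; rewrite -subr_eq0; apply/eqP; apply: LW0.
  rewrite addrC -scaleN1r Llin scaleN1r.
  have -> : - L c + L (co x) = (x - L c) + - (x - L (co x)).
    by rewrite opprB [RHS]addrC addrA subrK addrC.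
  by apply: WD => //; apply: WN; exact: coP.
have colin a x y : co (a *: x + y) = a *: co x + co y.
  apply: co_uniq; rewrite Llin opprD addrACA -scalerBr.
  by apply: WD; [apply: WZ; exact: coP|exact: coP].
move=> nWu.
(* The coordinate bound makes [co] Lipschitz with constant [k]. *)
have cco : continuous co.
  move=> x; apply/cvgrPdist_lt => e e0; apply/nbhs_normP; exists (e / k) => /=.
    by rewrite divr_gt0.
  move=> y xy.
  have -> : co x - co y = co (x - y).
    by rewrite addrC -scaleN1r -colin scaleN1r addrC.
  have := kP (co (x - y)) _ (coP (x - y)); rewrite -/L [L _ + _]addrC subrK => /le_lt_trans.
  by apply; rewrite -ltr_pdivlMl// mulrC.
have coW w : W w -> co w = 0.
  move=> Ww; apply: LW0; rewrite -[L _](subKr w).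
  by apply: WD => //; exact/WN/coP.
have : co u != 0.
  apply/eqP => cu0; apply: nWu; have := coP u.
  by rewrite cu0 L0 subr0.
move=> cu; have [i ui] : exists i, co u 0 i != 0.
  apply: contrapT => /forallNP ci; move/eqP: cu; apply; apply/rowP => i.
  by rewrite mxE; apply/eqP/negPn/negP; exact: ci.
exists (fun x => co x 0 i); split => //.
  split; first by move=> a x y; rewrite colin !mxE.
  by move=> x; apply: (@continuous_comp _ _ _ co (fun c : 'rV[R]_n => c 0 i));
    [exact: cco|exact: coord_continuous].
by move=> w Ww; rewrite coW// mxE.
Qed.
End Coordinates.

(** One [d] controls base point and step together: the displacement from [u] is below [d] times
    [|l| + 1], whence the divisor. *)
Lemma continuous_lt_near_ray {R : realType} {E : normedModType R}
    (G : E -> R) (u l : E) (a : R) :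
  continuous G -> G u < a -> exists2 d : R, 0 < d &
  forall x s, `|u - x| < d -> `|s| < d -> G (x + s *: l) < a.
Proof.
move=> cG ua; have ua0 : 0 < a - G u by rewrite subr_gt0.
have /cvgrPdist_lt/(_ _ ua0)/nbhs_normP[e /= e0 eP] := cG u.
have l1 : 0 < `|l| + 1 by rewrite ltr_wpDl.
exists (e / (`|l| + 1)); first by rewrite divr_gt0.
move=> x s ux sd.
have := eP (x + s *: l); rewrite /= => /(_ _)/wrap[].
  rewrite opprD addrA; apply: le_lt_trans (ler_normB _ _) _.
  rewrite normrZ -[ltRHS](divfK (lt0r_neq0 l1)) mulrDr mulr1 [ltLHS]addrC.
  by apply: ler_ltD => //; rewrite ler_wpM2r// ltW.
by rewrite ltr_norml => /andP[+ _]; lra.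
Qed.

(** * Attainment of the fibre maxima and of their minimum *)

Section MinMax.
Context {R : realType} {E : normedModType R} (V W : set E) (Phi : E -> R).
Hypothesis refl : reflexive_space R E.
Hypothesis VW : direct_sum V W.
Hypothesis dimV : finite_dim V.
Hypothesis C1Phi : C1 Phi.
Hypothesis coercive : forall M : R, exists r : R, forall w, W w -> r < `|w| -> M < Phi w.
Hypothesis qconcave : forall w, W w -> quasi_concave_on V (fun v => Phi (v + w)).
Hypothesis anticoercive : forall (B M : R), exists r : R, forall v w, V v -> W w ->
  `|w| <= B -> r < `|v| -> Phi (v + w) < M.
Hypothesis wlsc : forall v, V v -> weakly_lsc_on W (fun w => Phi (v + w)).

Let V0 : V 0. Proof. by case: VW => -[]. Qed.
Let VD x y : V x -> V y -> V (x + y). Proof. by case: VW => -[_ [+ _]] _; apply. Qed.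
Let VZ (a : R) x : V x -> V (a *: x). Proof. by case: VW => -[_ [_ +]] _; apply. Qed.
Let subW : Defs.subspace W. Proof. by case: VW => _ []. Qed.
Let W0 : W 0. Proof. by case: subW. Qed.
Let WD x y : W x -> W y -> W (x + y). Proof. by case: subW => _ [+ _]; apply. Qed.
Let WZ (a : R) x : W x -> W (a *: x). Proof. by case: subW => _ [_ +]; apply. Qed.
Let dPhi u : differentiable Phi u. Proof. by case: C1Phi. Qed.
Let cPhi : continuous Phi.
Proof. by move=> u; exact: differentiable_continuous. Qed.

(* A nonzero vector of V in the closure of W would span a line along which Phi
   tends to both +oo and -oo. *)
Lemma positive_distance v : V v -> v != 0 ->
  exists2 d : R, 0 < d & forall w, W w -> d <= `|v - w|.
Proof.
move=> Vv v0; apply: contrapT => none.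
have close d : 0 < d -> exists2 w, W w & `|v - w| < d.
  move=> d0; apply: contrapT => nw; apply: none; exists d => // w Ww.
  by rewrite leNgt; apply/negP => lt; apply: nw; exists w.
have [r rP] := coercive 0; have [r' r'P] := anticoercive 0 0.
have nv : 0 < `|v| by rewrite normr_gt0.
(* This puts [t *: v] beyond both growth thresholds, with a margin of 1 for its approximation by
   [W]. *)
pose t := (`|r| + `|r'| + 1) / `|v|.
have t0 : 0 < t by rewrite divr_gt0// ltr_wpDl// addr_ge0.
have nz : `|t *: v| = `|r| + `|r'| + 1.
  by rewrite normrZ gtr0_norm// divfK// gt_eqF.
have lr := ler_norm r; have lr' := ler_norm r'.
have n1 := normr_ge0 r; have n2 := normr_ge0 r'.
have Phiz : Phi (t *: v) < 0.
  rewrite -[t *: v]addr0; apply: r'P => //; first exact: VZ.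
    by rewrite normr0.
  by rewrite nz; lra.
have /cvgrPdist_lt/(_ (- Phi (t *: v))) := cPhi (t *: v).
rewrite oppr_gt0 => /(_ Phiz) /nbhs_normP[e /= e0 eP].
(* Closeness [e] keeps [Phi] negative at [t *: w], while closeness 1 keeps its norm above [r], where
   [Phi] is positive. *)
pose d := Num.min e 1.
have d0 : 0 < d by rewrite lt_min e0 ltr01.
have [w Ww vw] := close (d / t) (divr_gt0 d0 t0).
have zw : `|t *: v - t *: w| < d.
  by rewrite -scalerBr normrZ gtr0_norm// -ltr_pdivlMl// mulrC.
have [ze z1] : `|t *: v - t *: w| < e /\ `|t *: v - t *: w| < 1.
  by move: zw; rewrite lt_min => /andP.
have := eP (t *: w) ze; rewrite ltr_norml => /andP[+ _].
have : 0 < Phi (t *: w).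
  apply: rP; first exact: WZ.
  by have := lerB_dist (t *: v) (t *: w); lra.
lra.
Qed.

(** Outside a ball of [V] the values drop below the value at [v = 0], so a maximum over the compact
    ball is global. *)
Lemma fiber_max_attained w : W w ->
  exists v, V v /\ forall v', V v' -> Phi (v' + w) <= Phi (v + w).
Proof.
move=> Ww; have [r rP] := anticoercive `|w| (Phi w).
have r0 : 0 <= r.
  rewrite leNgt; apply/negP => r0; have := rP 0 w V0 Ww (lexx _).
  by rewrite normr0 add0r ltxx => /(_ r0).
have cB := compact_finite_dim_ball _ _ VW dimV positive_distance r.
have [||v vB vmax] := @compact_EVT_max _ _ (fun v => Phi (v + w)) _ _ cB.
- by exists 0; split => //=; rewrite normr0.
- apply: continuous_subspaceT => v.
  apply: (@continuous_comp _ _ _ (fun v => v + w) Phi); last exact: cPhi.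
  by apply: cvgD; [exact: cvg_id|exact: cvg_cst].
move: vB; rewrite inE => -[Vv _]; exists v; split=> // v' Vv'.
have [v'r|v'r] := leP `|v'| r; first by apply: vmax; rewrite inE.
apply: ltW; apply: lt_le_trans (rP v' w Vv' Ww (lexx _) v'r) _.
by rewrite -[X in Phi X <= _]add0r; apply: vmax; rewrite inE; split=> //=; rewrite normr0.
Qed.

(** Direct method, with sublevel sets [S a] of the fibre maximum. A weak limit along an ultrafilter
    containing all nonempty ones lies in each of them, by lower semicontinuity for every fixed
    [v]. *)
Lemma minmax_attained : exists2 w0, W w0 & forall w (a : R), W w ->
  (forall v, V v -> Phi (v + w) <= a) -> forall v, V v -> Phi (v + w0) <= a.
Proof.
pose S a := [set w | W w /\ forall v, V v -> Phi (v + w) <= a].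
pose B := [set A : set E | exists a, S a !=set0 /\ S a `<=` A].
have PB : ProperFilter B.
  apply: Build_ProperFilter_ex.
    by move=> A [a [[w Sw] SA]]; exists w; exact: SA.
  split.
  - have [v [Vv vmax]] := fiber_max_attained _ W0.
    by exists (Phi (v + 0)); split=> //; exists 0; split.
  - move=> A A' [a [nA SA]] [a' [nA' SA']].
    (* Sublevel sets are nested, so the smaller level serves both. *)
    wlog aa : a a' A A' nA SA nA' SA' / a <= a'.
      move=> H; have [/H|/ltW/H] := leP a a'; first by apply.
      by rewrite setIC; apply.
    exists a; split => // w [Ww wa]; split; first exact: SA.
    by apply: SA'; split=> // v Vv; exact: le_trans (wa v Vv) aa.
  - by move=> A A' AA' [a [nA SA]]; exists a; split=> //; exact: subset_trans AA'.
have [U [ultU BU]] := ultraFilterLemma PB.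
have PU : ProperFilter U by exact: ultra_proper.
have US a : S a !=set0 -> U (S a) by move=> nS; apply: BU; exists a; split.
have [v1 [Vv1 v1max]] := fiber_max_attained _ W0.
have nS1 : S (Phi (v1 + 0)) !=set0 by exists 0.
have [r rP] := coercive (Phi (v1 + 0)).
have Ur : U [set x | `|x| <= r].
  apply: filterS (US _ nS1) => w [Ww wa] /=; rewrite leNgt; apply/negP => /(rP _ Ww).
  by rewrite ltNge; have := wa 0 V0; rewrite add0r => ->.
have [x fx] := reflexive_ultrafilter_cvg U r refl ultU Ur.
have UW : U W by apply: filterS (US _ nS1) => w [].
have Wx : W x.
  apply: contrapT => nWx.
  have [f [df fW /eqP fx0]] := dual_elt_separates _ _ VW dimV positive_distance _ nWx.
  have f0 : f @ U --> (0 : R).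
    apply: cvg_trans (@cvg_cst _ (0 : R) _ U _).
    by apply: near_eq_cvg; apply: filterS UW => w /fW ->.
  by apply: fx0; rewrite -(cvg_lim _ (fx f df))// (cvg_lim _ f0).
exists x => // w a Ww wa v Vv; apply/ler_addgt0Pr => e e0.
have [fs [d [dfs [d0 dP]]]] := wlsc _ Vv x Wx e e0.
(* A basic weak neighbourhood involves finitely many functionals, hence belongs to [U]. *)
have Ufs : U [set y | forall f, f \in fs -> `|f y - f x| < d].
  elim: fs dfs {dP} => [|f fs IH] dfs; first by apply: filterS filterT => y _ f.
  have Uf : U [set y | `|f y - f x| < d].
    have /cvgrPdist_lt/(_ d d0) := fx f (dfs f (mem_head _ _)).
    by apply: filterS => y; rewrite distrC.
  have /IH Ufs : forall g, g \in fs -> dual_elt g.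
    by move=> g gs; apply: dfs; rewrite inE gs orbT.
  apply: filterS (filterI Uf Ufs) => y [yf yfs] g.
  by rewrite inE => /orP[/eqP -> //|/yfs].
have nS : S a !=set0 by exists w.
have [y [[Wy ya] yfs]] := filter_ex (filterI (US _ nS) Ufs).
have := dP y Wy yfs; have := ya v Vv; lra.
Qed.

(** * A critical point above the minimizer *)

Section CriticalPoint.
Variables (w0 : E) (c : R).
Hypothesis Ww0 : W w0.
Hypothesis max_w0 : forall v, V v -> Phi (v + w0) <= c.
Hypothesis c_min : forall w, W w -> exists v, V v /\ c <= Phi (v + w).

(** By [max_w0] these are exactly the points where the value is [c], the maximizers over [w0]. *)
Let K := V `&` [set v | c <= Phi (v + w0)].
Let F h v := 'd Phi (v + w0) h.

Let compact_K : compact K.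
Proof.
have [r rP] := anticoercive `|w0| c.
have -> : K = (V `&` [set v | `|v| <= r]) `&` [set v | c <= Phi (v + w0)].
  apply/seteqP; split=> v; last by case=> -[].
  move=> [Vv cv]; split => //; split => //=; rewrite leNgt; apply/negP => rv.
  by have := rP v w0 Vv Ww0 (lexx _) rv; rewrite ltNge cv.
apply: compact_closedI; first exact: (compact_finite_dim_ball _ _ VW dimV positive_distance).
apply: (@preimage_closed _ R (fun v => Phi (v + w0)) [set y | c <= y]).
  move=> v _; apply: (@continuous_comp _ _ _ (fun v => v + w0) Phi); last exact: cPhi.
  by apply: cvgD; [exact: cvg_id|exact: cvg_cst].
exact: closed_ge.
Qed.

(* Along a fixed direction l in W, quasi-concavity of Phi passes to the first order
   at the maximizers. *)
Lemma maximizers_segment_closed l : W l ->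
  segment_closed (K `&` [set v | 0 <= F l v]).
Proof.
move=> Wl x y t [[Vx /= cx] Fx] [[Vy /= cy] Fy] t01.
set z := _ + _.
have Vz : V z by apply: VD; exact: VZ.
have cz : c <= Phi (z + w0).
  by apply: le_trans (qconcave _ Ww0 _ _ _ Vx Vy t01); rewrite le_min cx.
split => //=; rewrite leNgt; apply/negP => Fz.
(* As [F l z] is negative, its half is larger, so this bound is absurd. *)
suff : F l z / 2 <= F l z by lra.
have a0 : 0 < - (F l z / 2) by lra.
have [d1 d10 d1P] := diff_ray_approx Phi (x + w0) l _ (dPhi _) a0.
have [d2 d20 d2P] := diff_ray_approx Phi (y + w0) l _ (dPhi _) a0.
apply: diff_ge_of_ray_ge => // e e0.
pose d := Num.min e (Num.min d1 d2).
have d0 : 0 < d by rewrite !lt_min e0 d10 d20.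
have [de dd1 dd2] : [/\ d <= e, d <= d1 & d <= d2].
  by rewrite /d !ge_min !lexx !orbT.
exists (d / 2); first lra.
set s := d / 2.
have s0 : 0 < s by rewrite /s; lra.
have := d1P s; have := d2P s.
rewrite -[x + w0 + _]addrA -[y + w0 + _]addrA -[z + w0 + _]addrA.
move=> /(_ _)/wrap[]; first by rewrite /s; lra.
move=> h2 /(_ _)/wrap[]; first by rewrite /s; lra.
move=> h1; move: h1 h2; rewrite !ler_norml => /andP[h1 _] /andP[h2 _].
have Ws : W (w0 + s *: l) by apply: WD => //; exact: WZ.
(* Both endpoints have value at least [c + s * (F l z / 2)] over [w0 + s *: l], since their slopes
   are nonnegative; quasi-concavity passes this to [z], whose value over [w0] is at most [c]. *)
have := qconcave _ Ws _ _ _ Vx Vy t01; rewrite -/z.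
have := max_w0 _ Vz; move: Fx Fy; rewrite /F /= in h1 h2 * => Fx Fy cz'.
move=> /(le_trans _); apply; rewrite le_min; apply/andP; split; nra.
Qed.

(** If [Phi] decreased along [l] at every maximizer, a small step from [w0] would push the whole
    fibre below [c], against [c_min]. *)
Lemma maximizers_ge0_nonempty l : W l -> K `&` [set v | 0 <= F l v] !=set0.
Proof.
move=> Wl; apply: contrapT => none.
have FK v : K v -> F l v < 0.
  by move=> Kv; rewrite ltNge; apply/negP => Fv; apply: none; exists v.
(* The bound covers [w0 + s *: l] for all [s < 1], so one radius handles large [v] for every such
   step. *)
have [r rP] := anticoercive (`|w0| + `|l|) c.
have cB := compact_finite_dim_ball _ _ VW dimV positive_distance r.
pose P (s : R) v := V v -> Phi (v + w0 + s *: l) < c.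
have nP : \forall s \near 0^'+, V `&` [set v | `|v| <= r] `<=` P s.
  apply: (proj1 (compact_near_coveringP _) cB) => v [Vv _].
  suff [d d0 dP] : exists2 d : R, 0 < d &
      forall v' s, `|v - v'| < d -> 0 < s < d -> P s v'.
    exists ([set v' | `|v - v'| < d], [set s | 0 < s < d]) => /=.
      split; first by apply/nbhs_normP; exists d.
      near=> s; apply/andP; split=> //; near: s; exact: nbhs_right_lt.
    by move=> [v' s] /= [vd sd]; exact: dP sd.
  (* Near a maximizer the slope stays negative and the mean value theorem applies; elsewhere the
     value itself stays below [c]. *)
  have [cv|cv] := leP c (Phi (v + w0)).
    have [d d0 dP] := continuous_lt_near_ray _ (v + w0) l 0
      (C1_continuous_diff _ l C1Phi) (FK v (conj Vv cv)).
    exists d => // v' s vd /andP[s0 sd] Vv'.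
    have [t /andP[t0 ts] tE] := diff_MVT Phi (v' + w0) l s dPhi s0.
    have := dP (v' + w0) t; rewrite opprD addrACA subrr addr0 => /(_ vd).
    rewrite gtr0_norm// => /(_ (lt_trans ts sd)).
    have := max_w0 _ Vv'; nra.
  have [d d0 dP] := continuous_lt_near_ray _ (v + w0) l c cPhi cv.
  exists d => // v' s vd /andP[s0 sd] Vv'; apply: dP; last by rewrite gtr0_norm.
  by rewrite opprD addrACA subrr addr0.
near (0 : R)^'+ => s.
have s0 : 0 < s by [].
have s1 : s < 1 by near: s; exact: nbhs_right_lt.
have Ws : W (w0 + s *: l) by apply: WD => //; exact: WZ.
have [v [Vv]] := c_min _ Ws; apply/negP; rewrite -ltNge.
have [vr|vr] := leP `|v| r.
  have sP : V `&` [set v | `|v| <= r] `<=` P s by near: s.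
  by rewrite addrA; exact: sP.
apply: rP => //; apply: le_trans (ler_normD _ _) _.
by rewrite lerD2l normrZ gtr0_norm// ler_piMl// ltW.
Unshelve. all: by end_near.
Qed.

Lemma critical_point_of_minmax :
  exists v, [/\ V v, Phi (v + w0) = c & forall h, 'd Phi (v + w0) h = 0].
Proof.
have F_lin (a : R) h k v : F (a *: h + k) v = a * F h v + F k v.
  by rewrite /F linearP.
have F_cont h : continuous (F h).
  move=> v; apply: (@continuous_comp _ _ _ (fun v => v + w0) (fun u => 'd Phi u h)).
    by apply: cvgD; [exact: cvg_id|exact: cvg_cst].
  exact: C1_continuous_diff.
have [v [Vv cv] Fv] := ge0_levels_common F W subW F_lin F_cont K compact_K
  maximizers_segment_closed maximizers_ge0_nonempty.
have vE : Phi (v + w0) = c by apply/eqP; rewrite eq_le max_w0.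
exists v; split=> // h.
have dN k : 'd Phi (v + w0) (- k) = - 'd Phi (v + w0) k by rewrite linearN.
have dW w : W w -> 'd Phi (v + w0) w = 0.
  move=> Ww; have := Fv _ Ww; have := Fv _ (WZ (-1) _ Ww).
  by rewrite scaleN1r /F dN; lra.
(* A positive slope along [V] would contradict maximality at [v]; using [z] and its opposite gives
   zero. *)
have dV_le z : V z -> 'd Phi (v + w0) z <= 0.
  move=> Vz; rewrite leNgt; apply/negP => dz.
  have [|d d0 dP] := diff_ray_approx Phi (v + w0) z ('d Phi (v + w0) z / 2) (dPhi _); first lra.
  have d2 : 0 < d / 2 < d by lra.
  have := dP _ d2; rewrite [v + w0 + _]addrAC ler_norml => /andP[+ _].
  have := max_w0 _ (VD _ _ Vv (VZ (d / 2) _ Vz)); rewrite vE; nra.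
have [_ [_ [/(_ h)[z [w [Vz [Ww ->]]]] _]]] := VW.
rewrite linearD (dW w Ww) addr0.
have := dV_le _ Vz; have := dV_le _ (VZ (-1) _ Vz); rewrite scaleN1r dN; lra.
Qed.

End CriticalPoint.
End MinMax.

Theorem theorem1 (R : realType) (E : completeNormedModType R)
  (V W : set E) (Phi : E -> R) :
  reflexive_space R E ->
  direct_sum V W -> finite_dim V ->
  C1 Phi ->
  (* (i) coercive on W *)
  (forall M : R, exists r : R, forall w, W w -> r < `|w| -> M < Phi w) ->
  (* (ii) quasi-concave in v *)
  (forall w, W w -> quasi_concave_on V (fun v => Phi (v + w))) ->
  (* (iii) -> -oo as ||v|| -> oo, uniformly for w bounded in W *)
  (forall (B M : R), exists r : R, forall v w, V v -> W w -> `|w| <= B ->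
     r < `|v| -> Phi (v + w) < M) ->
  (* (iv) weakly lsc in w *)
  (forall v, V v -> weakly_lsc_on W (fun w => Phi (v + w))) ->
  exists (c : R) (u : E),
    is_minmax Phi V W c /\ Phi u = c /\ forall h : E, 'd Phi u h = 0.
Proof.
move=> refl VW dimV C1Phi coercive qconcave anticoercive wlsc.
have max_attained := fiber_max_attained V W Phi VW dimV C1Phi coercive anticoercive.
have [w0 Ww0 w0P] := minmax_attained V W Phi refl VW dimV C1Phi coercive anticoercive wlsc.
have [v0 [Vv0 v0max]] := max_attained w0 Ww0.
(* Minimality of [w0] is applied with the fibre maximum over [w] as the level. *)
have c_min w : W w -> exists v, V v /\ Phi (v0 + w0) <= Phi (v + w).
  by move=> Ww; have [v [Vv vmax]] := max_attained w Ww;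
    exists v; split=> //; exact: w0P vmax _ _.
have [v [Vv vE dv]] := critical_point_of_minmax V W Phi VW dimV C1Phi coercive
  qconcave anticoercive w0 _ Ww0 v0max c_min.
exists (Phi (v0 + w0)), (v + w0); split=> //; split=> //; split=> //.
by exists w0; split=> //; split=> //; exists v0.
Qed.
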